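(* Let $\mathcal{D}$ be a (possibly infinite) strong digraph. Then the infimum of $\ell_{max}(\mathcal{F})\bigl(1-\lambda_S(\mathcal{F})\bigr)$ taken over all finite (strong) subdigraphs $\mathcal{F}$ of $\mathcal{D}$ is positive on $\mathcal{S}_{<}(\mathcal{D})$ if and only if $\mathcal{D}$ admits a finite cycle transversal: $$\inf_{\mathcal{F}\subseteq\mathcal{D}}\ \ell_{max}(\mathcal{F})\bigl(1-\lambda_S(\mathcal{F})\bigr)>0\quad \forall\, S\in\mathcal{S}_{<}(\mathcal{D})\iff |sct(\mathcal{D})|<\infty.$$
   Context: Digraphs may be infinite, may have loops, but have no multiple arcs. A digraph is strong (strongly connected) if for any pair of distinct vertices $v,w$ there is a path from $v$ to $w$; each vertex of a strong digraph has at least one arc leaving it. A directed cycle is a finite strong digraph in which exactly one arc leaves each vertex (a loop is a cycle of length 1, an undirected edge, i.e. a pair of opposite arcs, is a cycle of length 2); ''cycle'' always means directed cycle, and its length is its number of arcs. $\ell_{max}(\mathcal{F})$ is the length of a longest cycle of $\mathcal{F}$. Subdigraphs are not necessarily induced, and $\mathcal{F}\subseteq\mathcal{D}$ allows $\mathcal{F}=\mathcal{D}$ when $\mathcal{D}$ is finite. A cycle transversal of $\mathcal{D}$ is a set of vertices whose removal (together with all incident arcs) leaves a digraph with no cycles; $|sct(\mathcal{D})|$ is the size of a smallest cycle transversal, and $|sct(\mathcal{D})|=\infty$ if there is no finite one. A weighting of $\mathcal{D}$ is a positive function on its arcs. It is substochastic if for each vertex the sum of the weights of the arcs leaving it (its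 out-weight) is not greater than $1$, and truthly substochastic if moreover at least one vertex has out-weight strictly less than $1$. $\mathcal{S}_{<}(\mathcal{D})$ is the class of all truthly substochastic weightings of $\mathcal{D}$. For a finite subdigraph $\mathcal{F}$ of $\mathcal{D}$ weighted by $S$, $\lambda_S(\mathcal{F})$ is the Perron root (spectral radius) of its weighted adjacency matrix, whose $(v,w)$ entry is the weight of $(v,w)$ if $(v,w)$ is an arc of $\mathcal{F}$ and $0$ otherwise.
   Formalization: The formal theorem also assumes that countably many arcs leave each vertex; otherwise there is no substochastic weighting, the left side is vacuously true, and the claim fails, e.g. for the complete digraph on an uncountable vertex set. *)

(* Defs.v *)
From HB Require Import structures.
From mathcomp Require Import all_boot all_order all_algebra finmap.
From mathcomp Require Import all_classical all_reals all_analysis.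
From mathcomp Require Import complex.

Set Implicit Arguments.
Unset Strict Implicit.
Unset Printing Implicit Defensive.

Import Order.TTheory GRing.Theory Num.Theory.

Local Open Scope classical_set_scope.
Local Open Scope ring_scope.

(* A digraph is a relation [e : rel V] on its vertex type: loops are allowed,
   multiple arcs are not, and [V] may be infinite. *)

(* Digraphs are nonempty. The last clause only excludes the digraph made of one
   vertex without loop. *)
Definition strong (V : eqType) (e : rel V) : Prop :=
  [/\ inhabited V,
      forall v w, v != w -> exists2 p, path e v p & last v p = w
    & forall v, exists w, e v w].

(* The nonempty [c] with [ucycle e c] are the directed cycles, listed from an
   arbitrary starting vertex; [size c] is then the number of arcs of the cycle,
   and [[:: v]] is a loop. *)
Definition acyclic (V : eqType) (e : rel V) : Prop :=
  forall c : seq V, ucycle e c -> c = [::].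

Definition cycle_transversal (V : eqType) (e : rel V) (X : set V) : Prop :=
  acyclic (relpre (val : {v : V | v \notin X} -> V) e).

(* Cycles have no repeated vertex, hence at most [#|T|] arcs. The maximum is [0]
   if there is no cycle, which does not occur for a strong digraph. *)
Definition lmax (T : finType) (e : rel T) : nat :=
  \max_(n < #|T|.+1 | [exists c : n.-tuple T, ucycleb e c]) n.

Section SpectralRadius.
Variable R : realType.

Definition spectral_radius (n : nat) (A : 'M[R]_n) : R :=
  sup [set r : R | exists2 z : R[i],
         eigenvalue (map_mx (real_complex R) A) z & r = complex.Re `|z|].

Definition adjacency (T : finType) (e : rel T) (S : T -> T -> R) : 'M[R]_#|T| :=
  \matrix_(i, j) if e (enum_val i) (enum_val j)
                 then S (enum_val i) (enum_val j) else 0.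

End SpectralRadius.

(* Not necessarily induced. *)
Record finsubdigraph (V : choiceType) (e : rel V) := FinSubdigraph {
  fsvert : {fset V};
  fsarc : fsvert -> fsvert -> bool;
  fsarc_sub : forall x y : fsvert, fsarc x y -> e (val x) (val y) }.

Section Weighting.
Variables (R : realType) (V : choiceType) (e : rel V).

(* The values of [S] outside the arcs of [e] are irrelevant. *)
Definition weighting (S : V -> V -> R) : Prop := forall v w, e v w -> 0 < S v w.

Definition outweight (S : V -> V -> R) (v : V) : \bar R :=
  (\esum_(w in [set w | e v w]) (S v w)%:E)%E.

Definition substochastic (S : V -> V -> R) : Prop :=
  weighting S /\ forall v, (outweight S v <= 1)%E.

Definition truthly_substochastic (S : V -> V -> R) : Prop :=
  substochastic S /\ exists v, (outweight S v < 1)%E.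

Definition perron_root (S : V -> V -> R) (F : finsubdigraph e) : R :=
  spectral_radius (adjacency (@fsarc _ _ F) (fun x y => S (val x) (val y))).

End Weighting.

(* Main.v *)
Require Import Defs.
From HB Require Import structures.
From mathcomp Require Import all_boot all_order all_algebra finmap.
From mathcomp Require Import all_classical all_reals all_analysis.
From mathcomp Require Import complex ring lra.

Set Implicit Arguments.
Unset Strict Implicit.
Unset Printing Implicit Defensive.

Import Order.TTheory GRing.Theory Num.Theory.

Local Open Scope classical_set_scope.
Local Open Scope ring_scope.

(** The spectral radius of [A >= 0] is at most [mu] as soon as [A h <= mu h] for
    some [h > 0].  Given a finite transversal [X], following paths from the points
    of [X] to a vertex of out-weight less than 1 yields a function [g > 0] on the
    whole digraph with [S g <= g] everywhere and [S g <= (1 - delta) g] on [X].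
    On a finite strong subdigraph whose longest cycle has length [l], put
    [mu = 1 - delta / l].  Then [mu ^ l >= 1 - delta] by Bernoulli, and every
    cycle meets [X]; hence a potential [H > 0] converts the gain [1 - delta] on
    [X] into a gain [mu] at every vertex, and [h = g H] gives
    [lambda <= 1 - delta / l].

    Without a finite transversal there are infinitely many disjoint cycles [C n];
    giving their arcs weights [1 - eps n] with [size (C n) * eps n -> 0] makes the
    infimum nonpositive. *)

(** * Bounds on the spectral radius of a nonnegative matrix *)

(* [eigenvalue] refers to left eigenvectors, whence the pairing with [h]. *)
Lemma eigenvalue_norm_le (K : numFieldType) (n : nat) (A : 'M[K]_n)
    (h : 'I_n -> K) (mu z : K) :
  (forall i j, 0 <= A i j) -> (forall i, 0 < h i) ->
  (forall i, \sum_j A i j * h j <= mu * h i) ->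
  eigenvalue A z -> `|z| <= mu.
Proof.
move=> A_ge0 h_gt0 Ah /eigenvalueP [y yA y_neq0].
have Nyh_ge0 i : 0 <= `|y 0 i| * h i by rewrite mulr_ge0 // ltW.
have Nyh_gt0 : 0 < \sum_i `|y 0 i| * h i.
  rewrite lt_def sumr_ge0 // andbT; apply: contraNneq y_neq0.
  move=> /(psumr_eq0P (fun i _ => Nyh_ge0 i)) yh0.
  apply/eqP/rowP => i; rewrite mxE; apply/normr0_eq0/eqP.
  by have /eqP := yh0 i isT; rewrite mulf_eq0 (gt_eqF (h_gt0 i)) orbF.
rewrite -(ler_pM2r Nyh_gt0) !mulr_sumr.
have zy_le : \sum_i `|z| * (`|y 0 i| * h i) <=
    \sum_j (\sum_i `|y 0 i| * A i j) * h j.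
  apply: ler_sum => j _; rewrite mulrA (ler_wpM2r (ltW (h_gt0 j))) // -normrM.
  have := congr1 (fun u : 'rV_n => u 0 j) yA; rewrite !mxE => <-.
  apply: le_trans (ler_norm_sum _ _ _) _. apply: ler_sum => i _.
  by rewrite normrM (ger0_norm (A_ge0 i j)).
apply: le_trans zy_le _; under eq_bigr do rewrite mulr_suml.
rewrite exchange_big; apply: ler_sum => i _ /=.
under eq_bigr do rewrite -mulrA.
by rewrite -mulr_sumr mulrCA ler_wpM2l.
Qed.

Section SpectralRadiusBounds.
Variables (R : realType) (n : nat) (A : 'M[R]_n).
Hypothesis A_ge0 : forall i j, 0 <= A i j.

Lemma eigenvalue_modulus_le (h : 'I_n -> R) (mu : R) (z : R[i]) :
  (forall i, 0 < h i) -> (forall i, \sum_j A i j * h j <= mu * h i) ->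
  eigenvalue (map_mx (real_complex R) A) z -> complex.Re `|z| <= mu.
Proof.
move=> h_gt0 Ah Az; suff : `|z| <= (mu%:C)%C by case/andP.
apply: eigenvalue_norm_le (fun i => (h i)%:C%C) _ _ _ _ _ Az => [i j|i|i].
- by rewrite mxE -[0]/(0%:C)%C lecR.
- by rewrite -[0]/(0%:C)%C ltcR.
- rewrite -rmorphM /=; under eq_bigr do rewrite mxE -rmorphM.
  by rewrite -rmorph_sum lecR.
Qed.

Lemma spectral_radius_le (h : 'I_n -> R) (mu : R) :
  0 <= mu -> (forall i, 0 < h i) ->
  (forall i, \sum_j A i j * h j <= mu * h i) -> spectral_radius A <= mu.
Proof.
move=> mu_ge0 h_gt0 Ah; rewrite /spectral_radius; set E := [set r | _].
(* By convention [sup set0] is [0], whence the hypothesis [0 <= mu]. *)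
have [->|/set0P E0] := eqVneq E set0; first by rewrite sup0.
by apply: ge_sup => // r [z Az ->]; apply: eigenvalue_modulus_le Az.
Qed.

(** The row sums are bounded so that the moduli of the eigenvalues are bounded above, by the test
    vector [1]; otherwise [sup] need not dominate its set. *)
Lemma le_spectral_radius (mu a : R) :
  (forall i, \sum_j A i j <= mu) -> 0 <= a -> eigenvalue A a ->
  a <= spectral_radius A.
Proof.
move=> A_le a_ge0 /eigenvalueP[y yA y_neq0]; apply: ub_le_sup.
  exists mu => r [z Az ->].
  apply: eigenvalue_modulus_le (fun=> 1) _ _ _ _ Az => // i.
  by rewrite mulr1; under eq_bigr do rewrite mulr1.
exists (a%:C)%C; last by rewrite ger0_norm // -[0]/(0%:C)%C lecR.
apply/eigenvalueP; exists (map_mx (real_complex R) y).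
  by rewrite -map_mxM yA map_mxZ.
by rewrite map_mx_eq0.
Qed.

End SpectralRadiusBounds.

(** * A potential on a finite digraph *)

(* [H v] is the largest product of [a] along a simple path starting at [v];
   cutting off a cycle does not decrease the product. *)
Lemma cycle_potential (R : realFieldType) (T : finType) (e : rel T) (a : T -> R) :
  (forall v, 0 < a v) ->
  (forall c, ucycle e c -> c != [::] -> \prod_(v <- c) a v <= 1) ->
  exists H : T -> R, (forall v, 0 < H v) /\
    forall v w, e v w -> a v * H w <= H v.
Proof.
move=> a_gt0 a_cycle.
(* A simple path has fewer than [#|T|] arcs, so finitely many paths compete. The path without arcs
   contributes [a v > 0], so the default [0] is never the maximum. *)
pose H v := \big[Num.max/0]_(n < #|T|)
  \big[Num.max/0]_(p : n.-tuple T | path e v p && uniq (v :: p))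
    \prod_(u <- v :: p) a u.
have le_H v (p : seq T) : path e v p -> uniq (v :: p) ->
    \prod_(u <- v :: p) a u <= H v.
  move=> vp up; have szp : (size p < #|T|)%N.
    by have := max_card [in v :: p]; rewrite (card_uniqP up).
  apply: le_trans (le_bigmax_cond _ _ (j := Ordinal szp) _) => //=.
  by apply: (le_bigmax_cond _ _ (j := in_tuple p)); apply/andP.
have H_gt0 v : 0 < H v.
  by apply: lt_le_trans (le_H v [::] isT isT); rewrite big_seq1.
exists H; split=> // v w vw; rewrite -ler_pdivlMl //.
have H_ge0 : 0 <= (a v)^-1 * H v by rewrite mulr_ge0 ?invr_ge0 ?ltW.
apply: bigmax_le => // n _; apply: bigmax_le => // p /andP[wp up].
rewrite ler_pdivlMl //.
suff : \prod_(u <- [:: v, w & p]) a u <= H v by rewrite big_cons.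
have vs : path e v (w :: p) by rewrite /= vw.
have [v_wp|v_wp] := boolP (v \in w :: p); last by rewrite le_H //= v_wp.
case/splitPr: v_wp vs up => p1 p2; rewrite cat_path cat_uniq.
case/and3P=> vp1 lv vp2 /and3P[up1 vNp1 vup2].
rewrite -cat_cons big_cat /=; apply: le_trans (le_H v p2 vp2 vup2).
apply: ler_piMl; first by apply: prodr_ge0 => u _; apply: ltW.
apply: a_cycle => //; rewrite /ucycle /cycle rcons_path vp1 lv /= up1 andbT.
by move: vNp1; rewrite /= negb_or => /andP[].
Qed.

(** * Supersolutions with slack on a finite set of vertices *)

Section Supersolution.
Variables (R : realType) (V : choiceType) (e : rel V) (S : V -> V -> R).

Lemma sum_le_outweight (v : V) (s : seq V) :
  uniq s -> all (e v) s -> ((\sum_(w <- s) S v w)%:E <= outweight e S v)%E.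
Proof.
move=> us es; apply: esum_ge; exists [set` s].
  by split; [exact: finite_seq | move=> w /= /(allP es)].
by rewrite -fsbig_seq // sumEFin.
Qed.

Hypothesis S_sub : substochastic e S.

(** This is [S g <= g - slack] with the possibly infinite sum over out-neighbours tested on its
    finite partial sums, which is all that finite subdigraphs require. *)
Definition supersolution (slack g : V -> R) : Prop :=
  forall v s, uniq s -> all (e v) s ->
    \sum_(w <- s) S v w * g w <= g v - slack v.

Lemma supersolution_cst1 : supersolution (fun=> 0) (fun=> 1).
Proof.
move=> v s us es; under eq_bigr do rewrite mulr1.
by rewrite subr0 -lee_fin (le_trans (sum_le_outweight us es)) // S_sub.2.
Qed.

Lemma supersolution_deficient (v : V) : (outweight e S v < 1)%E ->
  exists2 eps, 0 < eps & supersolution (fun u => eps * (u == v)%:R) (fun=> 1).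
Proof.
move=> v_lt1.
have v_ge0 : (0 <= outweight e S v)%E.
  by apply: esum_ge0 => w vw; rewrite lee_fin ltW // S_sub.1.
have v_fin : outweight e S v \is a fin_num.
  by rewrite ge0_fin_numE // (lt_trans v_lt1) // ltry.
exists (1 - fine (outweight e S v)).
  by rewrite subr_gt0 -lte_fin fineK.
move=> u s us es; have [uv|_] := eqVneq u v; last first.
  by rewrite mulr0; apply: supersolution_cst1.
under eq_bigr do rewrite mulr1.
rewrite mulr1 subKr -lee_fin fineK //.
by rewrite uv in es *; apply: sum_le_outweight.
Qed.

(* Lowering [g] at [w], where there is slack, creates slack at every vertex with
   an arc to [w]. *)
Lemma supersolution_pred (v w : V) (g : V -> R) (eps : R) :
  e v w -> v != w -> (forall u, 0 < g u <= 1) -> 0 < eps ->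
  supersolution (fun u => eps * (u == w)%:R) g ->
  exists g' eps', [/\ forall u, 0 < g' u <= 1, 0 < eps' &
    supersolution (fun u => eps' * (u == v)%:R) g'].
Proof.
move=> vw vNw g01 eps_gt0 gS; have Svw := S_sub.1 _ _ vw.
(* The bound [d <= eps] preserves the inequality at [w], and [d < g w] keeps [g'] positive. *)
pose d := Num.min eps (g w / 2).
have gw_gt0 : 0 < g w by case/andP: (g01 w).
have d_gt0 : 0 < d by rewrite lt_min eps_gt0 divr_gt0.
have d_eps : d <= eps by rewrite ge_min lexx.
have d_gw : d < g w by rewrite gt_min; apply/orP; right; lra.
pose g' u := g u - d * (u == w)%:R.
have g'_le u : g' u <= g u by rewrite gerBl mulr_ge0 // ltW.
exists g', (S v w * d); split; last 1 first.
- move=> u s us es.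
  have le_sum : \sum_(y <- s) S u y * g' y <= \sum_(y <- s) S u y * g y.
    rewrite !big_seq; apply: ler_sum => y /(allP es) uy.
    by apply: ler_wpM2l (g'_le y); apply/ltW/S_sub.1.
  have [uv|uNv] := eqVneq u v; last first.
    apply: le_trans le_sum _; apply: le_trans (gS u s us es) _.
    rewrite /g' mulr0 subr0.
    by case: (u == w); rewrite ?mulr1 ?mulr0; lra.
  rewrite {u}uv in es le_sum *; rewrite mulr1 /g' (negPf vNw) mulr0 subr0.
  have [ws|wNs] := boolP (w \in s).
    under eq_bigr do rewrite mulrBr.
    rewrite sumrB; have -> : \sum_(y <- s) S v y * (d * (y == w)%:R) = S v w * d.
      rewrite (bigD1_seq w) //= eqxx mulr1 big1 ?addr0 // => y /negPf ->.
      by rewrite !mulr0.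
    have := gS v s us es; rewrite (negPf vNw) mulr0; lra.
  (* If [s] misses [w], the inequality for [w :: s] has the extra term [S v w * g w], which exceeds
     the slack [S v w * d] wanted at [v]. *)
  have := gS v (w :: s); rewrite /= wNs us vw es big_cons (negPf vNw) mulr0.
  move=> /(_ isT isT) gSv; have := ler_pM2l Svw d (g w).
  rewrite (ltW d_gw) => {}d_gw; move: le_sum; rewrite /g'; lra.
- move=> u; apply/andP; split; last by apply: le_trans (g'_le u) _; case/andP: (g01 u).
  rewrite /g' subr_gt0; case: eqP => [->|_]; first by rewrite mulr1.
  by rewrite mulr0; case/andP: (g01 u).
- exact: mulr_gt0.
Qed.

(** Slack is first available at a vertex of out-weight less than 1; induction on a path from [x] to
    that vertex carries it back to [x]. *)
Lemma supersolution_vertex (x : V) :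
  strong e -> (exists v, (outweight e S v < 1)%E) ->
  exists g eps, [/\ forall u, 0 < g u <= 1, 0 < eps &
    supersolution (fun u => eps * (u == x)%:R) g].
Proof.
move=> [_ e_conn _] [v0 v0_lt1].
have [eps0 eps0_gt0 S0] := supersolution_deficient v0_lt1.
have base : exists g eps, [/\ forall u, 0 < g u <= 1, 0 < eps &
    supersolution (fun u => eps * (u == v0)%:R) g].
  by exists (fun=> 1), eps0; split=> // u; rewrite ltr01 lexx.
have [-> //|xv0] := eqVneq x v0; have [p] := e_conn _ _ xv0.
elim: p x {xv0} => [|w p IHp] x /=; first by move=> _ ->.
case/andP=> xw wp lastp; have [g [eps [g01 eps_gt0 gS]]] := IHp w wp lastp.
have [->|xNw] := eqVneq x w; first by exists g, eps.
exact: supersolution_pred xw xNw g01 eps_gt0 gS.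
Qed.

Lemma supersolution_seq (X : seq V) :
  strong e -> (exists v, (outweight e S v < 1)%E) ->
  exists g delta, [/\ forall u, 0 < g u, 0 < delta < 1 &
    supersolution (fun u => delta * (u \in X)%:R * g u) g].
Proof.
move=> e_strong S_lt1.
(* Adding up the supersolutions of the single vertices adds up their slacks. The upper bound [M]
   serves to make the slack proportional to [g] afterwards. *)
have [g [M [eps [gM eps_gt0 gS]]]] : exists g M eps,
    [/\ forall u, 0 < g u <= M, 0 < eps &
      supersolution (fun u => eps * (u \in X)%:R) g].
  elim: X => [|x X [g [M [eps [gM eps_gt0 gS]]]]].
    exists (fun=> 1), 1, 1; split=> //; first by move=> u; rewrite ltr01 lexx.
    by move=> v s us es; rewrite in_nil mulr0; apply: supersolution_cst1.
  have [f [eta [f01 eta_gt0 fS]]] := supersolution_vertex x e_strong S_lt1.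
  exists (fun u => f u + g u), (1 + M), (Num.min eps eta); split.
  - by move=> u; have := f01 u; have := gM u; lra.
  - by rewrite lt_min eps_gt0.
  - move=> u s us es; have := gS u s us es; have := fS u s us es.
    under [X in _ -> _ -> X <= _]eq_bigr do rewrite mulrDr.
    rewrite big_split inE.
    have : Num.min eps eta <= eta by rewrite ge_min lexx orbT.
    have : Num.min eps eta <= eps by rewrite ge_min lexx.
    by case: (u == x); case: (u \in X); rewrite /= ?mulr1 ?mulr0; lra.
have M_gt0 : 0 < 1 + M.
  by have [[x] _ _] := e_strong; have := gM x; lra.
have d_gt0 : 0 < Num.min (eps / (1 + M)) (1 / 2).
  by rewrite lt_min divr_gt0 //; lra.
(* Since [g <= M], the first term gives [delta * g <= eps]; the second one ensures [delta < 1]. *)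
exists g, (Num.min (eps / (1 + M)) (1 / 2)); split.
- by move=> u; case/andP: (gM u).
- by rewrite d_gt0 gt_min; apply/orP; right; lra.
move=> u s us es; apply: le_trans (gS u s us es) _; rewrite lerD2l lerN2.
case: (u \in X); rewrite ?mulr0 ?mul0r // !mulr1.
apply: (@le_trans _ _ (eps / (1 + M) * (1 + M))); last by rewrite divfK ?gt_eqF.
apply: ler_pM; [exact: ltW| | by rewrite ge_min lexx |].
  by have := gM u; lra.
by have := gM u; lra.
Qed.

End Supersolution.

(** * The gap on finite strong subdigraphs, given a finite transversal *)

Lemma strong_cycle (V : eqType) (e : rel V) :
  strong e -> exists2 c, ucycle e c & c != [::].
Proof.
move=> [[v] e_conn e_out]; have [w vw] := e_out v.
have [wv|wNv] := eqVneq w v.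
  by rewrite wv in vw; exists [:: v]; rewrite // /ucycle /= vw.
have [p wp] := e_conn _ _ wNv.
case/shortenP: wp => q wq uq _ lastq; exists (w :: q) => //.
by rewrite /ucycle /cycle rcons_path wq lastq vw uq.
Qed.

Lemma leq_size_lmax (T : finType) (e : rel T) (c : seq T) :
  ucycle e c -> (size c <= lmax e)%N.
Proof.
move=> ec; have szc : (size c < #|T|.+1)%N.
  by rewrite ltnS; case/andP: ec => _ /card_uniqP <-; apply: max_card.
apply: (@leq_bigmax_cond _ _ _ (Ordinal szc)).
by apply/existsP; exists (in_tuple c).
Qed.

(** A cycle avoiding [X] lifts to the subtype of vertices outside [X], where acyclicity forces it to
    be empty. *)
Lemma transversal_meets_cycle (V : choiceType) (e : rel V) (X : set V) (c : seq V) :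
  cycle_transversal e X -> ucycle e c -> c != [::] -> has (mem X) c.
Proof.
move=> eX ec; apply: contraNT; rewrite -all_predC => /all_sigP[c' cE].
have : map val c' = c by rewrite cE.
move: ec => /[swap] <-; rewrite /ucycle cycle_map map_inj_uniq; last exact: val_inj.
by move=> /eX ->.
Qed.

Lemma bernoulli_le (R : realFieldType) (x : R) (n : nat) :
  0 <= x <= 1 -> 1 - n%:R * x <= (1 - x) ^+ n.
Proof.
case/andP=> x_ge0 x_le1; elim: n => [|n IHn]; first by rewrite mul0r subr0.
rewrite exprS -natr1; have nx_ge0 : 0 <= n%:R * x * x by rewrite !mulr_ge0.
have : (1 - x) * (1 - n%:R * x) <= (1 - x) * (1 - x) ^+ n.
  by rewrite ler_wpM2l ?subr_ge0.
lra.
Qed.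

Lemma adjacency_row_sum (R : realType) (T : finType) (e : rel T)
    (S : T -> T -> R) (f : T -> R) (i : 'I_#|T|) :
  \sum_j adjacency e S i j * f (enum_val j) =
  \sum_(w | e (enum_val i) w) S (enum_val i) w * f w.
Proof.
rewrite [RHS]big_mkcond /= (big_enum_val (A := T)) /=.
by apply: eq_bigr => j _; rewrite mxE; case: ifP => // _; rewrite mul0r.
Qed.

Lemma transversal_gap (R : realType) (V : choiceType) (e : rel V)
    (S : V -> V -> R) (g : V -> R) (delta : R) (X : seq V) (F : finsubdigraph e) :
  weighting e S -> (forall u, 0 < g u) -> 0 < delta < 1 ->
  supersolution e S (fun u => delta * (u \in X)%:R * g u) g ->
  cycle_transversal e [set` X] -> strong (@fsarc _ _ F) ->
  delta <= (lmax (@fsarc _ _ F))%:R * (1 - perron_root S F).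
Proof.
move=> S_gt0 g_gt0 /andP[d_gt0 d_lt1] gS eX F_strong.
set arc := @fsarc _ _ F; set l := lmax arc.
have l_gt0 : (0 < l)%N.
  have [c ec c0] := strong_cycle F_strong.
  by apply: leq_trans (leq_size_lmax ec); rewrite lt0n size_eq0.
have lR_gt0 : 0 < l%:R :> R by rewrite ltr0n.
have dl : 0 < delta / l%:R < 1.
  rewrite divr_gt0 // ltr_pdivrMr // mul1r (lt_le_trans d_lt1) //.
  by rewrite ler1n.
pose mu := 1 - delta / l%:R; have mu01 : 0 < mu < 1 by rewrite /mu; lra.
have [mu_gt0 mu_lt1] := andP mu01.
suff : perron_root S F <= mu.
  move: (perron_root S F) => lambda; rewrite -ler_pdivrMl // mulrC /mu; lra.
(* With this factor [gS] reads [S g <= b g]. *)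
pose b (v : fsvert F) := 1 - delta * (val v \in X)%:R.
have b01 v : 0 < b v <= 1.
  by rewrite /b; case: (_ \in X); rewrite ?mulr1 ?mulr0; lra.
have mu_l : 1 - delta <= mu ^+ l.
  have dlE : l%:R * (delta / l%:R) = delta by rewrite mulrC divfK // gt_eqF.
  by rewrite -[X in 1 - X]dlE; apply: bernoulli_le; lra.
(* The potential is taken for [b / mu]. A cycle of length [k] meets [X] and has [k <= l], so its
   product of [b] is at most [1 - delta <= mu ^+ l <= mu ^+ k]. *)
have [||H [H_gt0 HP]] := @cycle_potential R _ arc (fun v => mu^-1 * b v).
- by move=> v; rewrite mulr_gt0 ?invr_gt0 //; case/andP: (b01 v).
- move=> c ec c0.
  have : has (mem [set` X]) (map val c).
    apply: (transversal_meets_cycle eX); last by rewrite -size_eq0 size_map size_eq0.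
    case/andP: ec => ec uc; rewrite /ucycle map_inj_uniq ?uc ?andbT; last exact: val_inj.
    by rewrite cycle_map; apply: sub_cycle ec => x y; apply: fsarc_sub.
  rewrite has_map => /hasP[x xc /=]; rewrite mem_setE => xX.
  have prodb : \prod_(v <- c) b v <= 1 - delta.
    have uc : uniq c by case/andP: ec.
    rewrite (bigD1_seq x) //= {1}/b xX mulr1.
    apply: ler_piMr; first by rewrite subr_ge0 ltW.
    by apply: prodr_ile1 => v _; case/andP: (b01 v) => /ltW -> ->.
  rewrite big_split /= big_const_seq count_predT iter_mulr_1 exprVn.
  rewrite mulrC ler_pdivrMr ?exprn_gt0 // mul1r.
  apply: le_trans prodb _; apply: le_trans mu_l _.
  apply: ler_wiXn2l; [exact: ltW|exact: ltW|exact: leq_size_lmax].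
apply: (@spectral_radius_le R _ _ _ (fun i => g (val (enum_val i)) * H (enum_val i))).
- move=> i j; rewrite mxE; case: ifP => // ij.
  by apply/ltW/S_gt0/fsarc_sub.
- exact: ltW.
- by move=> i; rewrite mulr_gt0.
move=> i.
rewrite (adjacency_row_sum _ _ (fun v => g (val v) * H v)).
set v := enum_val i.
have bv_gt0 : 0 < b v by case/andP: (b01 v).
(* The potential gives [H w <= mu * H v / b v], a bound independent of [w]; its denominator then
   cancels against [S g <= b g]. *)
apply: (@le_trans _ _ (\sum_(w | arc v w)
   S (val v) (val w) * g (val w) * (mu * H v / b v))).
  apply: ler_sum => w vw; rewrite mulrA ler_wpM2l //.
    by rewrite mulr_ge0 ?ltW // S_gt0 // fsarc_sub.
  rewrite ler_pdivlMr // -ler_pdivrMl // [_ * b v]mulrC mulrA.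
  exact: HP.
rewrite -mulr_suml.
have : \sum_(w | arc v w) S (val v) (val w) * g (val w) <= b v * g (val v).
  have := gS (val v) (map val (enum (arc v))).
  rewrite map_inj_uniq ?enum_uniq; last exact: val_inj.
  rewrite big_map big_enum /= mulrBl mul1r; apply => //.
  by apply/allP => _ /mapP[w + ->]; rewrite mem_enum; apply: fsarc_sub.
have c_gt0 : 0 < mu * H v / b v by rewrite divr_gt0 // mulr_gt0.
rewrite -(ler_pM2r c_gt0) => /le_trans; apply.
by rewrite le_eqVlt; apply/orP; left; apply/eqP; field; rewrite gt_eqF.
Qed.

(** * Weightings with one prescribed value per vertex *)

Lemma sum_half_powers_le1 (R : realFieldType) (s : seq nat) :
  uniq s -> \sum_(n <- s) (1 / 2 : R) ^+ n.+1 <= 1.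
Proof.
move=> us; pose N := (\max_(n <- s) n).+1.
have ps : perm_eq s [seq n <- index_iota 0 N | n \in s].
  apply: uniq_perm => //; first by rewrite filter_uniq ?iota_uniq.
  move=> n; rewrite mem_filter mem_index_iota /=.
  by have [ns|//] := boolP (n \in s); rewrite ltnS leq_bigmax_seq.
rewrite (perm_big _ ps) big_filter big_mkcond /=.
apply: (@le_trans _ _ (\sum_(0 <= n < N) (1 / 2 : R) ^+ n.+1)).
  by apply: ler_sum => n _; case: ifP => // _; rewrite exprn_ge0.
have -> : \sum_(0 <= n < N) (1 / 2 : R) ^+ n.+1 = 1 - (1 / 2) ^+ N.
  elim: N {ps} => [|N IHN]; first by rewrite big_nil subrr.
  by rewrite big_nat_recr //= IHN exprS; lra.
by rewrite gerBl exprn_ge0.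
Qed.

Lemma sum_indicator_le (R : numDomainType) (T : eqType) (s : seq T) (a : T) (c : R) :
  uniq s -> 0 <= c -> \sum_(x <- s) (if x == a then c else 0) <= c.
Proof.
move=> us c_ge0; have [as_|aNs] := boolP (a \in s).
  by rewrite (bigD1_seq a) //= eqxx big1 ?addr0 // => x /negPf ->.
rewrite big1_seq // => x /andP[_ xs]; case: eqP => // xa.
by rewrite xa (negPf aNs) in xs.
Qed.

(** The arcs not leading to [succ v] share at most [eps v / 2] geometrically, along an enumeration
    of the out-neighbours, so the out-weight is at most [1 - eps v / 2]. Countability is essential:
    uncountably many positive weights have an infinite sum. *)
Lemma prescribed_weighting (R : realType) (V : choiceType) (e : rel V)
    (eps : V -> R) (succ : V -> V) :
  (forall v, countable [set w | e v w]) -> (forall v, 0 < eps v < 1) ->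
  exists S : V -> V -> R, [/\ weighting e S,
    forall v, (outweight e S v < 1)%E & forall v, S v (succ v) = 1 - eps v].
Proof.
move=> e_countable eps01.
have /choice[idx idx_inj] : forall v, exists f : V -> nat,
    {in [set w | e v w] &, injective f}.
  by move=> v; apply/countable_injP/e_countable.
pose S v w : R :=
  if w == succ v then 1 - eps v else eps v / 2 * (1 / 2) ^+ (idx v w).+1.
exists S; split; last by move=> v; rewrite /S eqxx.
- move=> v w _; have := eps01 v; rewrite /S; case: ifP => _ eps_v; first by lra.
  by rewrite mulr_gt0 ?exprn_gt0 //; lra.
move=> v; have eps_v := eps01 v; apply: (@le_lt_trans _ _ (1 - eps v / 2)%:E).
  apply: ge_ereal_sup => _ [A [/finite_seqP[s0 ->] eA] <-].
  pose s := undup s0; have us : uniq s by apply: undup_uniq.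
  have es w : w \in s -> e v w by rewrite mem_undup => /eA.
  have -> : [set` s0] = [set` s].
    by apply/seteqP; split=> w /=; rewrite mem_undup.
  rewrite -fsbig_seq // sumEFin lee_fin.
  have -> : 1 - eps v / 2 = (1 - eps v) + eps v / 2 by lra.
  apply: (@le_trans _ _ (\sum_(w <- s) ((if w == succ v then 1 - eps v else 0)
      + eps v / 2 * (1 / 2) ^+ (idx v w).+1))).
    apply: ler_sum => w _; rewrite /S; case: ifP => _; last by rewrite add0r.
    by rewrite lerDl mulr_ge0 ?exprn_ge0 //; lra.
  rewrite big_split /= lerD ?sum_indicator_le //; first by lra.
  rewrite -mulr_sumr ler_piMr //; first by lra.
  have := @sum_half_powers_le1 R [seq idx v w | w <- s].
  rewrite big_map; apply; rewrite map_inj_in_uniq // => w1 w2 /es vw1 /es vw2.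
  by apply: idx_inj; rewrite inE.
by rewrite lte_fin; lra.
Qed.

(** * Disjoint cycles and the subdigraphs they form *)

Lemma disjoint_cycles (V : choiceType) (e : rel V) :
  ~ (exists2 X : set V, finite_set X & cycle_transversal e X) ->
  exists C : nat -> seq V,
    [/\ forall n, ucycle e (C n), forall n, C n != [::] &
        forall m n v, v \in C m -> v \in C n -> m = n].
Proof.
move=> no_transversal.
(* Greedy choice: the vertices [L] of the cycles chosen so far form a finite set, hence not a
   transversal, so some cycle avoids them. *)
have /choice[next_cycle nextP] : forall L : seq V, exists c,
    [/\ ucycle e c, c != [::] & forall v, v \in c -> v \notin L].
  move=> L; apply: contrapT => noc; apply: no_transversal.
  exists [set` L] => // c ec; apply: contrapT => /eqP c0; apply: noc.
  exists (map val c); split.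
  - by move: ec; rewrite /ucycle cycle_map (map_inj_uniq val_inj).
  - by rewrite -size_eq0 size_map size_eq0.
  - by move=> _ /mapP[[v vNL] _ ->] /=; move: vNL; rewrite mem_setE.
pose L n := iter n (fun L => L ++ next_cycle L) [::].
have L_mono m n v : (m < n)%N -> v \in next_cycle (L m) -> v \in L n.
  elim: n => // n IHn; rewrite ltnS leq_eqVlt /= mem_cat.
  by case/predU1P => [-> ->|mn /(IHn mn) ->]; rewrite ?orbT.
exists (next_cycle \o L); split=> [n|n|m n v /= vm vn].
- by case: (nextP (L n)).
- by case: (nextP (L n)).
have [mn|nm|//] := ltngtP m n.
- by case: (nextP (L n)) => _ _ /(_ v vn); rewrite (L_mono m).
- by case: (nextP (L m)) => _ _ /(_ v vm); rewrite (L_mono n).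
Qed.

Section CycleSubdigraph.
Variables (V : choiceType) (e : rel V) (c : seq V).
Hypotheses (ec : ucycle e c) (c_neq0 : c != [::]).

Let A : {fset V} := [fset x in c]%fset.
Let arc (x y : A) : bool := val y == next c (val x).

Lemma cycle_subdigraph_sub (x y : A) : arc x y -> e (val x) (val y).
Proof.
move=> /eqP ->; apply: next_cycle; first by case/andP: ec.
by have := valP x; rewrite !inE.
Qed.

Definition cycle_subdigraph : finsubdigraph e := FinSubdigraph cycle_subdigraph_sub.

Let vertex : A.
Proof.
have /negPf c0 := c_neq0; have x0 : V by case: (c) c0 => [|x] //.
have xA : head x0 c \in A.
  by rewrite inE; case: (c) c0 => //= x s _; rewrite mem_head.
exact: [` xA]%fset.
Qed.

Lemma card_cycle_subdigraph : #|{: A}| = size c.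
Proof.
by rewrite -cardfE card_fseq undup_id //; case/andP: ec.
Qed.

Lemma cycle_subdigraph_strong : strong (@fsarc _ _ cycle_subdigraph).
Proof.
have uc : uniq c by case/andP: ec.
(* [p] is [c] lifted to the vertex type of the subdigraph. The arcs become the graph of [next p],
   which has [p] as its only orbit. *)
pose p : seq A := pmap insub c.
have pc : map val p = c.
  rewrite (pmap_filter (@insubK _ _ _)); apply/all_filterP/allP => x xc.
  by rewrite /= isSome_insub inE.
have up : uniq p by move: uc; rewrite -pc map_inj_uniq //; apply: val_inj.
have arcE x y : arc x y = (next p x == y).
  by rewrite /arc -[X in next X _]pc next_map // (inj_eq val_inj) eq_sym.
have in_p x : x \in p.
  by rewrite -(mem_map val_inj) pc; have := valP x; rewrite !inE.
split.
- exact: (inhabits vertex).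
- move=> v w _; have : fconnect (next p) v w.
    by rewrite (fconnect_cycle (cycle_next up)).
  case/connectP => q vq ->; exists q => //; apply: sub_path vq => x y /=.
  by rewrite arcE.
- by move=> v; exists (next p v); rewrite /= arcE.
Qed.

Lemma lmax_cycle_subdigraph : (lmax (@fsarc _ _ cycle_subdigraph) <= size c)%N.
Proof.
apply/bigmax_leqP => n _; rewrite -card_cycle_subdigraph -ltnS; exact: ltn_ord.
Qed.

(** Exactly one arc enters each vertex, from its predecessor on [c] and with weight [1 - eps]; so
    the all-ones row vector is a left eigenvector for [1 - eps]. *)
Lemma perron_root_cycle_subdigraph (R : realType) (S : V -> V -> R) (eps : R) :
  substochastic e S -> 0 <= eps <= 1 ->
  (forall v, v \in c -> S v (next c v) = 1 - eps) ->
  1 - eps <= perron_root S cycle_subdigraph.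
Proof.
move=> S_sub eps01 Sc; apply: (@le_spectral_radius R _ _ _ 1).
- move=> i j; rewrite mxE; case: ifP => // ij.
  by apply/ltW/S_sub.1/(@fsarc_sub _ _ cycle_subdigraph).
- move=> i; under eq_bigr do rewrite -[adjacency _ _ _ _]mulr1.
  rewrite (adjacency_row_sum _ _ (fun=> 1)); set v := enum_val i.
  have := supersolution_cst1 S_sub (v := val v)
    (s := map val (enum (@fsarc _ _ cycle_subdigraph v))).
  rewrite (map_inj_uniq val_inj) enum_uniq big_map big_enum subr0 /=; apply => //.
  apply/allP => _ /mapP[w + ->]; rewrite mem_enum.
  exact: (@fsarc_sub _ _ cycle_subdigraph).
- lra.
- apply/eigenvalueP; exists (const_mx 1).
    apply/rowP => j; rewrite !mxE mulr1.
    have uc : uniq c by case/andP: ec.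
    have y_c : val (enum_val j) \in c by have := valP (enum_val j); rewrite !inE.
    have x_A : prev c (val (enum_val j)) \in A by rewrite !inE mem_prev.
    rewrite (bigD1 (enum_rank [` x_A]%fset)) //= big1 ?addr0.
      rewrite !mxE mul1r enum_rankK /arc /= next_prev // eqxx.
      by rewrite -[X in S _ X](next_prev uc) Sc // mem_prev.
    move=> i i_neq; rewrite !mxE mul1r; case: ifP => // /eqP yE.
    case/eqP: i_neq; apply/eqP; rewrite -(inj_eq enum_val_inj) enum_rankK.
    by apply/eqP/val_inj; rewrite /= yE prev_next.
  apply/eqP => /matrixP /(_ 0 (enum_rank vertex)); rewrite !mxE.
  by apply/eqP/oner_neq0.
Qed.

End CycleSubdigraph.

(** * The equivalence *)

Theorem proposition3 (R : realType) (V : choiceType) (e : rel V)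
    (e_strong : strong e)
    (e_countable : forall v, countable [set w | e v w]) :
  (forall S : V -> V -> R, truthly_substochastic e S ->
     (0 < ereal_inf [set ((lmax (@fsarc _ _ F))%:R * (1 - perron_root S F))%:E
                    | F in [set F : finsubdigraph e | strong (@fsarc _ _ F)]])%E)
  <-> exists2 X : set V, finite_set X & cycle_transversal e X.
Proof.
split=> [inf_gt0|[_ /finite_seqP[X ->] eX] S [S_sub S_lt1]]; last first.
  have [g [delta [g_gt0 delta01 gS]]] := supersolution_seq S_sub X e_strong S_lt1.
  have [delta_gt0 _] := andP delta01.
  apply: (@lt_le_trans _ _ delta%:E); first by rewrite lte_fin.
  apply: le_ereal_inf_tmp => _ [F F_strong <-]; rewrite lee_fin.
  exact: transversal_gap S_sub.1 g_gt0 delta01 gS eX F_strong.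
apply: contrapT => /disjoint_cycles[C [C_cycle C_neq0 C_disj]].
have size_gt0 n : 0 < (size (C n))%:R :> R by rewrite ltr0n lt0n size_eq0.
(* Chosen so that [size (C n) * eps n] is [1 / (n + 2)], which tends to [0]; the shift by 2 keeps
   [eps 0 < 1] even if [C 0] is a loop. *)
pose eps n : R := n.+2%:R^-1 / (size (C n))%:R.
have eps01 n : 0 < eps n < 1.
  apply/andP; split; first by rewrite divr_gt0 // invr_gt0 ltr0n.
  rewrite ltr_pdivrMr // mul1r.
  apply: (@lt_le_trans _ _ 1); first by rewrite invf_lt1 ?ltr1n ?ltr0n.
  by rewrite ler1n -(ltr0n R).
(* By disjointness a vertex lies on at most one [C n], which determines its [eps] and successor.
   Elsewhere the pair [(1 / 2, v)] is a filler, and [v] need not carry a loop. *)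
have /choice[p pP] : forall v, exists q : R * V, 0 < q.1 < 1 /\
    forall n, v \in C n -> q = (eps n, next (C n) v).
  move=> v; have [[n vn]|noC] := pselect (exists n, v \in C n).
    exists (eps n, next (C n) v); split=> [|m vm]; first exact: eps01.
    by rewrite (C_disj _ _ _ vm vn).
  exists (1 / 2, v); split=> /=; first by lra.
  by move=> n vn; case: noC; exists n.
have [S [S_gt0 S_lt1 S_succ]] := prescribed_weighting
  (fun v => (p v).2) e_countable (fun v => (pP v).1).
have S_sub : substochastic e S by split=> // v; apply/ltW.
have [[v0] _ _] := e_strong.
have {}inf_gt0 := inf_gt0 S (conj S_sub (ex_intro _ v0 (S_lt1 v0))).
set E := [set _ | _ in _] in inf_gt0.
(* Tested on [C n], where [lmax] is at most [size (C n)] and [1 - lambda] at most [eps n]. *)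
have inf_le n : (ereal_inf E <= (n.+2%:R^-1)%:E)%E.
  pose F := cycle_subdigraph (C_cycle n).
  apply: (@le_trans _ _ ((lmax (@fsarc _ _ F))%:R * (1 - perron_root S F))%:E).
    by apply: ereal_inf_lbound; exists F => //; apply: cycle_subdigraph_strong.
  have eps_n := eps01 n.
  have lambda_ge : 1 - eps n <= perron_root S F.
    apply: perron_root_cycle_subdigraph => // [|v vn]; first by lra.
    by have := S_succ v; have [_ /(_ n vn) ->] := pP v.
  rewrite lee_fin; move: (perron_root S F) lambda_ge => lambda lambda_ge.
  apply: (@le_trans _ _ ((size (C n))%:R * eps n)); last first.
    by rewrite /eps mulrC divfK // gt_eqF.
  apply: (@le_trans _ _ ((lmax (@fsarc _ _ F))%:R * eps n)).
    by rewrite ler_wpM2l ?ler0n //; lra.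
  by rewrite ler_wpM2r ?ler_nat ?lmax_cycle_subdigraph //; lra.
have inf_fin : ereal_inf E \is a fin_num.
  by rewrite ge0_fin_numE ?ltW // (le_lt_trans (inf_le 0)) ?ltry.
have : 0 < fine (ereal_inf E) by rewrite fine_gt0 // inf_gt0 -ge0_fin_numE // ltW.
(* A positive real infimum would exceed some [1 / (k + 1)], whereas it is at most [1 / (k + 2)]. *)
case/ltr_add_invr => k; rewrite add0r; apply/negP; rewrite -leNgt.
rewrite -lee_fin fineK // (le_trans (inf_le k)) // lee_fin.
by rewrite lef_pV2 ?posrE ?ltr0n // ler_nat.
Qed.
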